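(* Let $K$ be an $R_1MF$-domain and let $M_n(K)$ be the full matrix semigroup of $n\times n$ matrices over $K$ (under matrix multiplication). Then every automorphism of the semigroup $M_n(K)$ is semi-inner.
   Context: A domain is commutative, associative, with $1$. A domain $K$ with quotient field $\tilde K$ is an $R_1MF$-domain if every $k\times l$ matrix over $K$ (any $k,l$) whose rank over $\tilde K$ equals $1$ is a product of a $k\times 1$ matrix over $K$ and a $1\times l$ matrix over $K$. $M_n(K)$ is identified with the semigroup of $K$-linear endomorphisms of the free module $K^n$ (the free $n$-generated algebra with zero multiplication). A semigroup automorphism $\Phi$ of $M_n(K)$ is semi-inner if there are a ring automorphism $\varphi$ of $K$ and a bijection $s:K^n\to K^n$ with $s(a+b)=s(a)+s(b)$ and $s(\alpha a)=\varphi(\alpha)s(a)$ for all $a,b\in K^n$, $\alpha\in K$, such that $\Phi(A)=sAs^{-1}$ for all $A\in M_n(K)$.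
   Formalization: The case n = 1 is excluded, since the claim fails there: for K = Q, the map x to 1/x with 0 to 0 is an automorphism of the semigroup M_1(Q) that is not additive, hence not semi-inner. *)

(* Defs.v *)
From HB Require Import structures.
From mathcomp Require Import all_boot all_order all_algebra.

Set Implicit Arguments.
Unset Strict Implicit.
Unset Printing Implicit Defensive.

Import GRing.Theory.
Local Open Scope ring_scope.

Definition R1MF_domain (K : idomainType) : Prop :=
  forall (k l : nat) (A : 'M[K]_(k, l)),
    \rank (map_mx (@tofrac K) A) = 1%N ->
    exists (u : 'M[K]_(k, 1)) (v : 'M[K]_(1, l)), A = u *m v.

Definition semigroup_automorphism (K : idomainType) (n : nat)
    (Phi : 'M[K]_n -> 'M[K]_n) : Prop :=
  bijective Phi /\ {morph Phi : A B / A *m B}.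

Definition semilinear_over (K : idomainType) (n : nat) (phi : K -> K)
    (s : 'cV[K]_n -> 'cV[K]_n) : Prop :=
  {morph s : a b / a + b} /\
  (forall (alpha : K) (a : 'cV[K]_n), s (alpha *: a) = phi alpha *: s a).

(* A matrix is identified with the endomorphism v |-> A *m v of the module
   of column vectors; s' is the inverse of s, so the last clause reads
   Phi A = s A s^-1 as maps. *)
Definition semi_inner (K : idomainType) (n : nat)
    (Phi : 'M[K]_n -> 'M[K]_n) : Prop :=
  exists (phi : {rmorphism K -> K}) (s s' : 'cV[K]_n -> 'cV[K]_n),
    [/\ bijective phi, cancel s s' /\ cancel s' s, semilinear_over phi s
      & forall (A : 'M[K]_n) (v : 'cV[K]_n), Phi A *m v = s (A *m s' v)].

(* Main.v *)
Require Import Defs.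
From HB Require Import structures.
From mathcomp Require Import all_boot all_order all_algebra.

(** The matrix units E_ij are carried to a second system of matrix units, and
    the whole automorphism is read off from it.

    The images of the diagonal units E_ii are n nonzero, pairwise orthogonal
    idempotents.  Over the quotient field their row spaces are in direct sum
    inside an n-dimensional space, so each of them has rank exactly 1
    ([orthogonal_idempotents_rank1]).  The factorisation property of K then
    gives Phi E_00 = u *m v, and idempotence forces v *m u = 1
    ([rank1_idempotent_factor]).

    Transporting u and v by u_i = Phi E_i0 *m u and v_i = v *m Phi E_0i gives a
    basis of K^n and its dual basis, hence mutually inverse matrices U and V.
    For every A, the (i, j) entry of V *m Phi A *m U is
    v *m Phi (E_0i *m A *m E_j0) *m u, and E_0i *m A *m E_j0 = A_ij E_00.  So it
    depends on A_ij only, through a map phi : K -> K that does not depend on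
    (i, j): Phi A = U *m phi(A) *m V, with phi applied entrywise
    ([automorphism_entrywise]).  As Phi is multiplicative, so is the entrywise
    map, and for n >= 2 this makes phi additive, because a + b is an entry of
    a product of two matrices with entries a, b, 1 and 0
    ([entrywise_morph_additive]).  The semilinear bijection is then
    s x = U *m phi(x). *)

Set Implicit Arguments.
Unset Strict Implicit.
Unset Printing Implicit Defensive.

Import GRing.Theory.
Local Open Scope ring_scope.

(** Right multiplication by Q i fixes the row space of Q i and kills that of
    every other Q j, so the row spaces are independent; n independent nonzero
    subspaces of an n-dimensional space are lines. *)
Lemma orthogonal_idempotents_rank1 (F : fieldType) (n : nat)
    (Q : 'I_n -> 'M[F]_n) :
    (forall i, Q i != 0) -> (forall i, Q i *m Q i = Q i) ->
    (forall i j, i != j -> Q i *m Q j = 0) ->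
  forall i, \rank (Q i) = 1%N.
Proof.
move=> Qn0 Qid Qorth i.
have dxQ : mxdirect (\sum_i Q i).
  apply/mxdirect_sumsP => k _; apply/eqP/rowV0P => w.
  rewrite sub_capmx => /andP[/submxP[x ->] /sub_sumsmxP[y wE]].
  rewrite -(Qid k) mulmxA wE mulmx_suml big1 // => j jk.
  by rewrite -mulmxA Qorth // mulmx0.
have Qgt0 k : (0 < \rank (Q k))%N by rewrite lt0n mxrank_eq0.
have : (\sum_k \rank (Q k) <= n)%N.
  by rewrite -(mxdirectP dxQ) /= rank_leq_row.
rewrite (bigD1 i) //= => le_n.
have : (n.-1 <= \sum_(k | k != i) \rank (Q k))%N.
  have -> : n.-1 = (\sum_(k | k != i) 1)%N.
    by rewrite sum1_card cardC1 card_ord.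
  by apply: leq_sum => k _.
move=> ge_n; apply/eqP; rewrite eqn_leq Qgt0 andbT.
rewrite -(leq_add2r n.-1) add1n (ltn_predK (ltn_ord i)).
by apply: leq_trans le_n; rewrite leq_add2l.
Qed.

(** The product v *m u is a scalar c, and u *m v *m u *m v = c *: (u *m v);
    over a domain, comparing at a nonzero entry of u *m v gives c = 1. *)
Lemma rank1_idempotent_factor (K : idomainType) (n : nat)
    (u : 'M[K]_(n, 1)) (v : 'M[K]_(1, n)) :
    u *m v != 0 -> u *m v *m (u *m v) = u *m v -> v *m u = 1%:M.
Proof.
move=> uvn0; rewrite mulmxA -(mulmxA u v u) (mx11_scalar (v *m u)).
rewrite mul_mx_scalar -scalemxAl => cuv; congr (_%:M).
case: (altP ((v *m u) 0 0 =P 1)) => // cn1; case/eqP: uvn0.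
apply/matrixP => i j; rewrite [RHS]mxE; apply/eqP.
move/matrixP/(_ i j)/eqP: cuv; rewrite [X in X == _]mxE.
by rewrite -subr_eq0 -[X in _ - X]mul1r -mulrBl mulf_eq0 subr_eq0 (negPf cn1).
Qed.

Lemma sandwich_delta (R : comNzRingType) (m n p q : nat) (A : 'M[R]_(m, n))
    (i : 'I_m) (j : 'I_n) (k : 'I_p) (l : 'I_q) :
  delta_mx k i *m A *m delta_mx j l = A i j *: delta_mx k l.
Proof.
apply/matrixP => a b; rewrite !mxE (bigD1 j) //= big1 ?addr0 => [|c cj].
  rewrite mxE (bigD1 i) //= big1 ?addr0 => [|c ci].
    by rewrite !mxE !eqxx andbT -mulrA mulrCA -natrM mulnb.
  by rewrite mxE (negPf ci) andbF mul0r.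
by rewrite [delta_mx j l _ _]mxE (negPf cj) mulr0.
Qed.

Section MatrixUnits.

Variables (K : idomainType) (n : nat) (Phi : 'M[K]_n.+1 -> 'M[K]_n.+1).
Hypothesis hPhi : semigroup_automorphism Phi.

Local Notation E i j := (@delta_mx K n.+1 n.+1 i j).

Let PhiM : {morph Phi : A B / A *m B} := proj2 hPhi.

Lemma automorphism0 : Phi 0 = 0.
Proof.
case: hPhi => -[Psi PhiK PsiK] _.
by rewrite -{1}(mul0mx _ (Psi 0)) PhiM PsiK mulmx0.
Qed.

Lemma automorphism_unit_neq0 i j : Phi (E i j) != 0.
Proof.
have inj := bij_inj (proj1 hPhi).
rewrite -automorphism0 (inj_eq inj); apply/eqP => /matrixP/(_ i j)/eqP.
by rewrite !mxE !eqxx oner_eq0.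
Qed.

Lemma automorphism_unit_rank1 i :
  \rank (map_mx (@tofrac K) (Phi (E i i))) = 1%N.
Proof.
apply: (orthogonal_idempotents_rank1
  (Q := fun i => map_mx (@tofrac K) (Phi (E i i)))) => {i} [i|i|i j ij].
- apply: contra (automorphism_unit_neq0 i i) => /eqP/matrixP Q0.
  apply/eqP/matrixP => k l; have /eqP := Q0 k l.
  by rewrite !mxE tofrac_eq0 => /eqP.
- by rewrite -map_mxM -PhiM mul_delta_mx.
by rewrite -map_mxM -PhiM mul_delta_mx_0 // automorphism0 map_mx0.
Qed.

(** The bases are u_i = Phi E_i0 *m u and v_j = v *m Phi E_0j; that one map phi
    serves all entries is because every entry is first moved to position
    (0, 0) by matrix units. *)
Lemma automorphism_entrywise : R1MF_domain K ->
  exists (phi : K -> K) (U V : 'M[K]_n.+1),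
    [/\ bijective phi, U *m V = 1%:M
      & forall A, Phi A = U *m map_mx phi A *m V].
Proof.
move=> hK; have [u [v Puv]] := hK _ _ _ (automorphism_unit_rank1 0).
have vu1 : v *m u = 1%:M.
  apply: rank1_idempotent_factor; rewrite -Puv ?automorphism_unit_neq0 //.
  by rewrite -PhiM mul_delta_mx.
pose phi a := (v *m Phi (a *: E 0 0) *m u) 0 0.
pose U : 'M[K]_n.+1 := \matrix_(k, i) (Phi (E i 0) *m u) k 0.
pose V : 'M[K]_n.+1 := \matrix_(i, k) (v *m Phi (E 0 i)) 0 k.
have colU i : col i U = Phi (E i 0) *m u.
  by apply/matrixP => a b; rewrite mxE mxE ord1.
have rowV i : row i V = v *m Phi (E 0 i).
  by apply/matrixP => a b; rewrite mxE mxE ord1.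
have VAU A : V *m Phi A *m U = map_mx phi A.
  apply/matrixP => i j.
  have -> : (V *m Phi A *m U) i j = (row i V *m Phi A *m col j U) 0 0.
    by rewrite -row_mul !mxE; apply: eq_bigr => k _; rewrite !mxE.
  rewrite [RHS]mxE rowV colU /phi -(sandwich_delta A i j 0 0).
  by rewrite !PhiM !mulmxA.
have phiE a : Phi (a *: E 0 0) = phi a *: Phi (E 0 0).
  have {1}-> : a *: E 0 0 = E 0 0 *m (a *: E 0 0) *m E 0 0.
    by rewrite sandwich_delta mxE !mxE !eqxx mulr1.
  rewrite 2!PhiM Puv !mulmxA -(mulmxA u) -(mulmxA u) [v *m _ *m u]mx11_scalar.
  by rewrite mul_mx_scalar -scalemxAl.
have phi0 : phi 0 = 0.
  by rewrite /phi scale0r automorphism0 mulmx0 mul0mx mxE.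
have phi1 : phi 1 = 1.
  by rewrite /phi scale1r Puv !mulmxA vu1 mul1mx vu1 mxE.
have VU1 : V *m U = 1%:M.
  apply/matrixP => i j.
  have -> : (V *m U) i j = (row i V *m col j U) 0 0.
    by rewrite !mxE; apply: eq_bigr => k _; rewrite !mxE.
  rewrite rowV colU mulmxA -(mulmxA v) -PhiM mul_delta_mx_cond.
  by rewrite -scaler_nat [RHS]mxE -/(phi _); case: eqP; rewrite ?phi1 ?phi0.
have UV1 := mulmx1C VU1.
exists phi, U, V; split => // [|A]; last first.
  by rewrite -VAU !mulmxA UV1 mul1mx -mulmxA UV1 mulmx1.
case: (proj1 hPhi) => Psi PhiK PsiK.
exists (fun b => Psi (b *: Phi (E 0 0)) 0 0) => [a|b].
  by rewrite -phiE PhiK !mxE !eqxx mulr1.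
(* The preimage of b *: Phi E_00 is a multiple of E_00, since its image is
   unchanged by multiplication by Phi E_00 on both sides. *)
set B := Psi _.
have EB : B 0 0 *: E 0 0 = B.
  apply: (bij_inj (proj1 hPhi)); rewrite -sandwich_delta !PhiM PsiK.
  by rewrite -scalemxAr -scalemxAl -!PhiM !mul_delta_mx.
rewrite /phi EB PsiK Puv -scalemxAr -scalemxAl !mulmxA vu1 mul1mx vu1 !mxE.
by rewrite mulr1.
Qed.

End MatrixUnits.

(** The sum a + b is the (0, 0) entry of the product of a matrix with first row
    (a, b, 0, ..., 0) and one with first column (1, 1, 0, ..., 0). *)
Lemma entrywise_morph_additive (R : pzRingType) (n : nat) (phi : R -> R) :
    phi 0 = 0 -> phi 1 = 1 ->
    {morph (fun A : 'M[R]_n.+2 => map_mx phi A) : A B / A *m B} ->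
  {morph phi : a b / a + b}.
Proof.
move=> phi0 phi1 phiM a b.
pose A : 'M[R]_n.+2 :=
  \matrix_(i, j) if j == 0 then a else if j == 1 then b else 0.
pose B : 'M[R]_n.+2 := \matrix_(i, j) if (i == 0) || (i == 1) then 1 else 0.
have /matrixP/(_ 0 0) := phiM A B; rewrite !mxE !big_ord_recl !big1.
- by rewrite !mxE /= !mulr1 !addr0 phi1 !mulr1.
- by move=> i _; rewrite !mxE /= phi0 mul0r.
by move=> i _; rewrite !mxE /= mul0r.
Qed.

Theorem corollary1p1 (K : idomainType) (n : nat) (Phi : 'M[K]_n -> 'M[K]_n)
    (hn : n <> 1%N) (hK : R1MF_domain K) (hPhi : semigroup_automorphism Phi) :
  semi_inner Phi.
Proof.
case: n => [|[|n]] in Phi hn hPhi *.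
- (* K^0 is the zero module. *)
  exists idfun, id, id; split=> //; first by exists id.
  by move=> A v; rewrite [LHS]flatmx0 [RHS]flatmx0.
- by case: hn.
have [phi [U [V [phi_bij UV1 PhiE]]]] := automorphism_entrywise hPhi hK.
have VU1 := mulmx1C UV1.
have VPhiU A : V *m Phi A *m U = map_mx phi A.
  by rewrite PhiE !mulmxA VU1 mul1mx -mulmxA VU1 mulmx1.
have mapM : {morph (fun A : 'M[K]_n.+2 => map_mx phi A) : A B / A *m B}.
  move=> A B; rewrite -!VPhiU (proj2 hPhi) !mulmxA.
  by rewrite -[V *m Phi A *m U *m V]mulmxA UV1 mulmx1.
have phi0 : phi 0 = 0.
  have /matrixP/(_ 0 0) := VPhiU 0.
  by rewrite automorphism0 // mulmx0 mul0mx !mxE => <-.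
have phiM : {morph phi : a b / a * b}.
  move=> a b; have /matrixP/(_ 0 0) := mapM (a *: delta_mx 0 0) b%:M.
  rewrite mul_mx_scalar !mxE /= !mulr1 big_ord_recl big1 ?addr0.
    by rewrite !mxE /= !mulr1 mulrC.
  by move=> i _; rewrite !mxE /= mulr0 phi0 mul0r.
have phi1 : phi 1 = 1.
  have [psi _ psiK] := phi_bij.
  by rewrite -[LHS]mulr1 -{2}(psiK 1) -phiM mul1r psiK.
have phiD := entrywise_morph_additive phi0 phi1 mapM.
pose phi_add := GRing.isNmodMorphism.Build K K phi (conj phi0 phiD).
pose phi_mul := GRing.isMonoidMorphism.Build K K phi (conj phi1 phiM).
pose phiR : {rmorphism K -> K} := HB.pack phi phi_add phi_mul.
have [psi phiK psiK] := phi_bij.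
have psi_mxK (y : 'cV[K]_n.+2) : map_mx phiR (map_mx psi y) = y.
  by apply/matrixP => i j; rewrite !mxE /= psiK.
exists phiR, (fun x => U *m map_mx phiR x), (fun y => map_mx psi (V *m y)).
split=> //.
- split=> x.
    by rewrite mulmxA VU1 mul1mx; apply/matrixP => i j; rewrite !mxE phiK.
  by rewrite psi_mxK mulmxA UV1 mul1mx.
- split=> [x y|a x]; first by rewrite map_mxD mulmxDr.
  by rewrite map_mxZ -scalemxAr.
by move=> A x; rewrite map_mxM psi_mxK PhiE !mulmxA.
Qed.
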